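(* Suppose that $b$ satisfies all the drift conditions stated in the context, let $Y$ be the solution of $Y_t=Y_0+\int_0^t b(s,Y_s)\,ds+Z_t$, $t\in[0,T]$, and let $\Lambda$ be the random variable such that $$|Z_t-Z_s|\le\Lambda|t-s|^\lambda,\qquad t,s\in[0,T].$$ Then, for any $r>0$: 1) there exists a constant $M_3(r,T)>0$ depending only on $r$, $T$, $\lambda$, $\gamma$ and the constant $c$ from the lower bound $b(t,y)\ge\frac{c}{(y-\varphi(t))^\gamma}$, $(t,y)\in\mathcal D_0\setminus\mathcal D_{y_*}$, such that for all $t\in[0,T]$ $$(Y_t-\varphi(t))^{-r}\le M_3(r,T)\,\tilde\Lambda^{\frac{r}{\gamma\lambda+\lambda-1}},$$ where $$\tilde\Lambda:=\max\left\{\Lambda,\ K,\ (2\beta)^{\lambda-1}\left(\frac{(Y_0-\varphi(0))\wedge y_*}{2}\right)^{1-\lambda-\gamma\lambda}\right\}$$ with $$\beta:=\frac{\lambda^{\frac{\lambda}{1-\lambda}}-\lambda^{\frac{1}{1-\lambda}}}{c^{\frac{\lambda}{1-\lambda}}}>0;$$ 2) additionally, if $\Lambda$ can be chosen in such a way that $\mathbb E\Lambda^{\frac{r}{\gamma\lambda+\lambda-1}}<\infty$, then $$\mathbb E\Big[\sup_{t\in[0,T]}(Y_t-\varphi(t))^{-r}\Big]<\infty.$$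
   Context: Fix $T\in(0,\infty)$ and $\lambda\in(0,1)$. Let $\varphi:[0,T]\to\mathbb R$ be $\lambda$-Hölder continuous, with deterministic constant $K>0$ such that $|\varphi(t)-\varphi(s)|\le K|t-s|^\lambda$ for all $t,s\in[0,T]$. For $a\ge 0$ let $\mathcal D_a := \{(t,y) : t\in[0,T],\ y\in(\varphi(t)+a,\infty)\}$. The initial value $Y_0$ is a deterministic constant with $Y_0>\varphi(0)$. The noise $Z=\{Z_t,\ t\in[0,T]\}$ is a stochastic process such that $Z_0=0$ a.s. and there is a random variable $\Lambda=\Lambda(\omega)\in(0,\infty)$ with $|Z_t-Z_s|\le\Lambda|t-s|^\lambda$ for all $t,s\in[0,T]$. All equations are understood pathwise. Assumptions on the drift $b$: (A1) $b:\mathcal D_0\to\mathbb R$ is continuous. (A2) For any $\varepsilon>0$ there is a constant $c_\varepsilon>0$ such that $|b(t,y_1)-b(t,y_2)|\le c_\varepsilon|y_1-y_2|$ for all $(t,y_1),(t,y_2)\in\mathcal D_\varepsilon$. (A3) There are positive constants $y_*$, $c$, $\gamma$ such that $b(t,y)\ge \frac{c}{(y-\varphi(t))^\gamma}$ for all $(t,y)\in\mathcal D_0\setminus\mathcal D_{y_*}$. (A4) The constant $\gamma$ from (A3) satisfies $\gamma>\frac{1-\lambda}{\lambda}$. Under (A1)–(A4) the equation has a unique continuous solution $Y$ on $[0,T]$, and $Y_t>\varphi(t)$ for all $t\in[0,T]$. *)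

(* Defs.v *)
From HB Require Import structures.
From mathcomp Require Import all_boot all_order all_algebra.
From mathcomp Require Import all_classical all_reals all_analysis.
Import Order.TTheory GRing.Theory Num.Theory.
Import numFieldNormedType.Exports.

Set Implicit Arguments.
Unset Strict Implicit.
Unset Printing Implicit Defensive.

Local Open Scope classical_set_scope.
Local Open Scope ring_scope.

Section deterministic.
Context {R : realType}.
Implicit Types (T lam a K c gamma ystar : R) (phi f : R -> R).

(* For [lam != 0] one has [0 `^ lam = 0], so the case [t = s] is harmless. *)
Definition holder_on T lam K f : Prop :=
  forall t s : R, t \in `[0, T] -> s \in `[0, T] ->
    `|f t - f s| <= K * `|t - s| `^ lam.

Definition region phi T a : set (R * R) :=
  [set p | p.1 \in `[0, T] /\ phi p.1 + a < p.2].

(* The drift is a total function [R * R -> R]; only its values on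
   [region phi T 0] are ever constrained or used. *)
Definition drift_continuous phi T (b : R * R -> R) : Prop :=
  {within region phi T 0, continuous b}.

Definition drift_lipschitz phi T (b : R * R -> R) : Prop :=
  forall eps, 0 < eps -> exists2 C : R, 0 < C &
    forall t y1 y2, region phi T eps (t, y1) -> region phi T eps (t, y2) ->
      `|b (t, y1) - b (t, y2)| <= C * `|y1 - y2|.

Definition drift_explosive phi T ystar c gamma (b : R * R -> R) : Prop :=
  forall t y, (region phi T 0 `\` region phi T ystar) (t, y) ->
    c / (y - phi t) `^ gamma <= b (t, y).

(* [y] is a continuous solution on [0, T], started at [y0], of the equation
   driven by the single path [z].  The condition [phi t < y t] says that
   [(t, y t)] stays in the domain of the drift; with continuity it makes the
   integrand continuous on [0, t], so the integral is the Riemann one. *)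
Definition path_solution T phi (b : R * R -> R) (y0 : R) (z y : R -> R) : Prop :=
  [/\ {within `[0, T], continuous y},
      y 0 = y0,
      forall t : R, t \in `[0, T] -> phi t < y t &
      forall t : R, t \in `[0, T] ->
        y t = y0 + (\int[lebesgue_measure]_(s in `[0, t]) b (s, y s)) + z t].

Definition beta lam c : R :=
  (lam `^ (lam / (1 - lam)) - lam `^ (1 / (1 - lam))) / c `^ (lam / (1 - lam)).

Definition Lambda_tilde lam gamma c ystar K phi (y0 L : R) : R :=
  Num.max L (Num.max K
    ((2 * beta lam c) `^ (lam - 1) *
     (Num.min (y0 - phi 0) ystar / 2) `^ (1 - lam - gamma * lam))).

End deterministic.

(* [L] is a positive pathwise Hoelder constant of the process [Z]. *)
Definition holder_modulus {R : realType} {d : measure_display}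
    {Omega : measurableType d} (T lam : R) (Z : R -> Omega -> R)
    (L : Omega -> R) : Prop :=
  forall w, 0 < L w /\ holder_on T lam (L w) (fun t => Z t w).

(* Main.v *)
Require Import Defs.
From HB Require Import structures.
From mathcomp Require Import all_boot all_order all_algebra.
From mathcomp Require Import all_classical all_reals all_analysis.
From mathcomp Require Import measurable_realfun.
From mathcomp Require Import ring lra.
Import Order.TTheory GRing.Theory Num.Theory.
Import numFieldNormedType.Exports.

Set Implicit Arguments.
Unset Strict Implicit.
Unset Printing Implicit Defensive.

Local Open Scope classical_set_scope.
Local Open Scope ring_scope.

(** The drift pushes upwards so strongly near the lower curve [phi] that a
    path [y] cannot come too close to it.  Put [kappa := gamma * lam + lam - 1],
    which is positive by the lower bound on [gamma], and let [Lt] be the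
    number [Lambda_tilde], which dominates the Hoelder constants of [phi] and
    of the noise.

    Fix a level [e > 0] with [e <= y0 - phi 0] and [e <= ystar], and suppose
    that [y t - phi t < e].  After the last time [tau < t] at which the
    distance [y - phi] is at least [e] ([last_passage]), the distance stays
    below [e], so that the drift is at least [c / e `^ gamma] on [(tau, t]]
    ([path_solution_increment_ge]).  With [x := t - tau] this gives
    [y t - phi t >= e + c / e `^ gamma * x - 2 * Lt * x `^ lam], where the last
    term bounds the increments of the noise and of [phi].  Since
    [x `^ lam] is concave, it lies below affine functions, and one can choose
    such a function so that the noise term is at most
    [e / 2 + c / e `^ gamma * x] as soon as [Lt * e `^ kappa] is small compared
    with [c `^ lam] ([noise_le_half_barrier_add_drift]).  Hence
    [y - phi >= e / 2] on the whole of [[0, T]]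
    ([path_solution_half_barrier]).

    Both the smallness condition and the constraint by the initial distance
    and by [ystar] hold once [Lt * e `^ kappa] is at most a constant that
    depends on [lam] and [c] only; for the second one this is precisely what
    the third term in the maximum [Lambda_tilde] is made for.  So
    [e = (q / Lt) `^ kappa^-1] is admissible with [q] the smaller of the two
    constants, and [(e / 2) `^ (- r)] is the claimed multiple of
    [Lt `^ (r / kappa)] ([path_solution_inverse_moment]).

    The moment bound follows by integration, because [Lambda_tilde] is the
    maximum of the random Hoelder constant and of a deterministic number.  The
    supremum over an uncountable set of times need not be measurable, but the
    integral of a nonnegative function is a supremum over the simple functions
    below it, so that a measurable almost sure majorant suffices
    ([le_integral_of_measurable_majorant]). *)

(** * Noise against drift *)

(** A substitute for the tangent of the concave function [x `^ p] at [s]: one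
    of the two terms alone dominates, depending on the side of [s] on which
    [x] lies. *)
Lemma powR_le_affine {R : realType} (p s x : R) :
  0 < p <= 1 -> 0 < s -> 0 <= x -> x `^ p <= s `^ p + s `^ (p - 1) * x.
Proof.
move=> /andP[p0 p1] s0 x0; have [xs|sx] := leP x s.
  rewrite (@le_trans _ _ (s `^ p))//.
    by rewrite ge0_ler_powR ?nnegrE// ltW.
  by rewrite lerDl mulr_ge0 ?powR_ge0.
rewrite -(@mulr_powRB1 _ x)// mulrC.
rewrite (@le_trans _ _ (s `^ (p - 1) * x))//; last by rewrite lerDr powR_ge0.
rewrite ler_wpM2r// -opprB !powRN lef_pV2 ?posrE ?powR_gt0//;
  last exact: lt_trans sx.
by rewrite ge0_ler_powR ?nnegrE ?subr_ge0// ltW.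
Qed.

(** The affine majorant of [x `^ lam] is taken at the point [s] where
    [2 * L * s `^ lam = e / 2]; the smallness hypothesis says exactly that its
    slope does not exceed the lower bound [c / e `^ gamma] of the drift below
    the level [e]. *)
Lemma noise_le_half_barrier_add_drift {R : realType} (lam gamma c L e x : R) :
  0 < lam < 1 -> 0 < c -> 0 < L -> 0 < e ->
  4 * L * e `^ (gamma * lam + lam - 1) <= (2 * c) `^ lam -> 0 <= x ->
  2 * L * x `^ lam <= e / 2 + c / e `^ gamma * x.
Proof.
move=> /andP[lam0 lam1] c0 L0 e0 small x0.
have L4 : 0 < 4 * L by rewrite mulr_gt0.
set s := (e / (4 * L)) `^ lam^-1.
have s0 : 0 < s by rewrite powR_gt0// divr_gt0.
have slam : s `^ lam = e / (4 * L).
  by rewrite -powRrM mulVf ?gt_eqF// powRr1// divr_ge0 ?ltW.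
have eg0 : 0 < e `^ gamma by rewrite powR_gt0.
(* The smallness hypothesis, multiplied by [e / (4 * L)], is the [lam]-th
   power of this inequality. *)
have es : e * e `^ gamma <= 2 * c * s.
  rewrite leNgt; apply/negP => /(@gt0_ltr_powR _ lam lam0).
  rewrite !nnegrE !mulr_ge0 ?ltW// => /(_ erefl erefl).
  rewrite ltNge => /negP; apply.
  rewrite [leRHS]powRM ?mulr_ge0 ?(ltW c0) ?(ltW s0)// slam.
  rewrite powRM ?(ltW e0) ?(ltW eg0)// -powRrM.
  rewrite (_ : e `^ lam * _ = e * e `^ (gamma * lam + lam - 1)).
    by rewrite [leRHS]mulrCA ler_wpM2l ?(ltW e0)// ler_pdivlMr// mulrC.
  rewrite -powRD; last by rewrite (gt_eqF e0) implybT.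
  rewrite -[X in _ = X * _](powRr1 (ltW e0)) -powRD;
    last by rewrite (gt_eqF e0) implybT.
  by congr (_ `^ _); lra.
have sB : s * s `^ (lam - 1) = s `^ lam by rewrite mulr_powRB1// ltW.
rewrite (@le_trans _ _ (2 * L * (s `^ lam + s `^ (lam - 1) * x)))//.
  by rewrite ler_wpM2l ?mulr_ge0 ?(ltW L0)// powR_le_affine ?lam0 ?(ltW lam1).
rewrite mulrDr lerD//.
  by rewrite slam le_eqVlt; apply/orP; left; apply/eqP; field; rewrite gt_eqF.
rewrite mulrA ler_wpM2r//.
have -> : s `^ (lam - 1) = e / (4 * L) / s.
  by rewrite -slam -sB mulrAC mulfV ?mul1r// gt_eqF.
rewrite ler_pdivlMr// (_ : 2 * L * _ * _ = e * e `^ gamma / (2 * s)).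
  by rewrite ler_pdivrMr ?mulr_gt0//; nra.
by field; rewrite !gt_eqF.
Qed.

(** * Paths above the curve *)

Lemma holder_on_continuous {R : realType} (T lam K : R) (f : R -> R) :
  0 < lam -> 0 < K -> holder_on T lam K f -> {within `[0, T], continuous f}.
Proof.
move=> lam0 K0 hf; apply/subspace_continuousP => t tT.
apply/cvgrPdist_lt => e e0.
have eK : 0 < e / K by rewrite divr_gt0.
have d0 : 0 < (e / K) `^ lam^-1 by rewrite powR_gt0.
apply/nbhs_ballP; exists ((e / K) `^ lam^-1) => //= s ts sT.
rewrite (le_lt_trans (hf _ _ _ _))//.
rewrite mulrC -ltr_pdivlMr//.
have -> : e / K = ((e / K) `^ lam^-1) `^ lam.
  by rewrite -powRrM mulVf ?gt_eqF// powRr1// ltW.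
by apply: gt0_ltr_powR; rewrite ?nnegrE ?powR_ge0.
Qed.

Lemma last_passage {R : realType} (g : R -> R) (t e : R) :
  0 <= t -> {within `[0, t], continuous g} -> e <= g 0 -> g t < e ->
  exists tau, [/\ 0 <= tau, tau < t, e <= g tau &
    forall s, tau < s -> s <= t -> g s < e].
Proof.
move=> t0 /subspace_continuousP cg eg0 gte.
pose A := [set s | 0 <= s <= t /\ e <= g s].
have A0 : A 0 by split => //; rewrite lexx.
have supA : has_sup A.
  by split; [exists 0|exists t => s [/andP[]]].
pose tau := sup A.
have tau0 : 0 <= tau by apply: ub_le_sup => //; case: supA.
have taut : tau <= t by apply: ge_sup; [exists 0|move=> s [/andP[]]].
have etau : e <= g tau.
  rewrite leNgt; apply/negP => gtau.
  have := cg tau; rewrite /= in_itv/= tau0 taut => /(_ isT)/cvgrPdist_lt.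
  have d0 : 0 < e - g tau by rewrite subr_gt0.
  move=> /(_ _ d0)/nbhs_ballP[/= d dpos near].
  have [s As sd] := sup_adherent dpos supA.
  have stau : s <= tau by apply: ub_le_sup => //; case: supA.
  case: As => st es.
  have : `|g tau - g s| < e - g tau.
    apply: near; last by rewrite /= in_itv.
    by rewrite /ball/= ger0_norm ?subr_ge0//; rewrite -/tau in sd; lra.
  by rewrite ltr_norml => /andP[]; lra.
exists tau; split => //.
  rewrite lt_neqAle taut andbT; apply/eqP => ttau.
  by move: etau; rewrite ttau leNgt gte.
move=> s taus st; rewrite ltNge; apply/negP => es.
have : s <= tau.
  apply: ub_le_sup; first by case: supA.
  by split => //; rewrite st andbT (le_trans tau0)// ltW.
by rewrite leNgt taus.
Qed.

Lemma drift_path_continuous {R : realType} (T : R) (phi : R -> R) b (y : R -> R) :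
  drift_continuous phi T b -> {within `[0, T], continuous y} ->
  (forall t, t \in `[0, T] -> phi t < y t) ->
  {within `[0, T], continuous (fun s => b (s, y s))}.
Proof.
move=> /subspace_continuousP cb /subspace_continuousP cy phiy.
apply/subspace_continuousP => t tT.
have reg s : `[0, T]%classic s -> region phi T 0 (s, y s).
  by move=> sT; split => //=; rewrite addr0 phiy.
apply: (@cvg_comp _ _ _ (fun s => (s, y s)) b _ _ _ _ (cb (t, y t) (reg _ tT))).
move=> P wP.
have idt : s @[s --> within `[0, T] (nbhs t)] --> nbhs t by exact: cvg_within.
have cyt : y s @[s --> within `[0, T] (nbhs t)] --> nbhs (y t) by exact: cy.
have near_reg : nbhs t
    [set s | `[0, T]%classic s -> region phi T 0 (s, y s) -> P (s, y s)].
  exact: cvg_pair idt cyt _ wP.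
change (nbhs t [set s | `[0, T]%classic s -> P (s, y s)]).
by apply: filterS near_reg => s sP sT; exact: sP sT (reg _ sT).
Qed.

(** Only the differences of the equation at two times matter: the initial
    value cancels and the integral over [(tau, t]] remains. *)
Lemma path_solution_increment_ge {R : realType} (T y0 a tau t : R)
    (phi z y : R -> R) b :
  drift_continuous phi T b -> path_solution T phi b y0 z y ->
  0 <= tau -> tau < t -> t <= T ->
  (forall s, tau < s -> s <= t -> a <= b (s, y s)) ->
  a * (t - tau) + (z t - z tau) <= y t - y tau.
Proof.
move=> cb [cy _ phiy sol] tau0 taut tT ab.
have ib : lebesgue_measure.-integrable `[0, t] (EFin \o (fun s => b (s, y s))).
  apply: continuous_compact_integrable; first exact: segment_compact.
  apply: (@continuous_subspaceW _ _ _ `[0, T]).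
    by apply: subset_itvl; rewrite bnd_simp.
  exact: (drift_path_continuous cb).
have sub : `]tau, t] `<=` `[0, t].
  by apply: subset_itvr; rewrite bnd_simp.
have incr : \int[lebesgue_measure]_(s in `[0, t]) b (s, y s) -
    \int[lebesgue_measure]_(s in `[0, tau]) b (s, y s) =
    \int[lebesgue_measure]_(s in `]tau, t]) b (s, y s).
  by rewrite Rintegral_itvB ?bnd_simp// ltW.
have t0 := le_trans tau0 (ltW taut); have tauT := le_trans (ltW taut) tT.
rewrite (sol t) ?in_itv/= ?t0// (sol tau) ?in_itv/= ?tau0//.
suff : a * (t - tau) <= \int[lebesgue_measure]_(s in `]tau, t]) b (s, y s).
  by rewrite -incr => ?; lra.
have <- : \int[lebesgue_measure]_(s in `]tau, t]) a = a * (t - tau).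
  by rewrite Rintegral_cst//= lebesgue_measure_itv/= lte_fin taut.
apply: le_Rintegral => //.
- have : lebesgue_measure.-integrable `[tau, t] (EFin \o (fun=> a)); last first.
    apply: integrableS => //.
    exact: subset_itv_oc_cc.
  apply: continuous_compact_integrable; first exact: segment_compact.
  by apply: continuous_subspaceT; exact: cst_continuous.
- apply: integrableS ib => //.
- by move=> s; rewrite /= in_itv/= => /andP[]; exact: ab.
Qed.

(** The pathwise barrier: a path that has left the level [e] downwards is
    pushed back by a drift of size at least [c / e `^ gamma], while [phi] and
    the noise contribute at most [2 * L * x `^ lam] during a time [x]. *)
Lemma path_solution_half_barrier {R : realType} (T lam gamma c ystar y0 L e : R)
    (phi z y : R -> R) b :
  0 < lam < 1 -> 0 < gamma -> 0 < c -> 0 < L -> 0 < e ->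
  holder_on T lam L phi -> holder_on T lam L z ->
  drift_continuous phi T b -> drift_explosive phi T ystar c gamma b ->
  path_solution T phi b y0 z y ->
  e <= y0 - phi 0 -> e <= ystar ->
  4 * L * e `^ (gamma * lam + lam - 1) <= (2 * c) `^ lam ->
  forall t, t \in `[0, T] -> e / 2 <= y t - phi t.
Proof.
move=> /[dup] lam01 /andP[lam0 lam1] gamma0 c0 L0 e0 hphi hz cb eb.
move=> /[dup] sol [cy yy0 phiy _] ey0 eystar small t.
rewrite in_itv/= => /andP[t0 tT].
have [|gte] := leP e (y t - phi t); first by apply: le_trans; lra.
have cphi := holder_on_continuous lam0 L0 hphi.
have cg : {within `[0, t], continuous (fun s => y s - phi s)}.
  apply: (@continuous_subspaceW _ _ _ `[0, T]).
    by apply: subset_itvl; rewrite bnd_simp.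
  by move=> s; apply: cvgB; [exact: cy|exact: cphi].
have [|tau [tau0 taut etau below]] := last_passage t0 cg _ gte.
  by rewrite yy0.
have sT s : tau < s -> s <= t -> s \in `[0, T].
  by move=> taus st; rewrite in_itv/= (le_trans tau0 (ltW taus)) (le_trans st).
have tauT : tau \in `[0, T] by rewrite in_itv/= tau0 (le_trans (ltW taut)).
have tT' : t \in `[0, T] by apply: sT.
have incr : c / e `^ gamma * (t - tau) + (z t - z tau) <= y t - y tau.
  apply: (path_solution_increment_ge cb sol) => // s taus st.
  have ys0 : 0 < y s - phi s by rewrite subr_gt0 phiy// sT.
  apply: le_trans (eb s (y s) _); last first.
    split; first by split => /=; rewrite ?addr0 ?phiy ?sT.
    by move=> [_ /=]; have := below _ taus st; lra.
  rewrite ler_wpM2l ?(ltW c0)// lef_pV2 ?posrE ?powR_gt0//.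
  by rewrite ge0_ler_powR ?nnegrE ?ltW// below.
have ttau0 : 0 <= t - tau by rewrite subr_ge0 ltW.
have := noise_le_half_barrier_add_drift lam01 c0 L0 e0 small ttau0.
have := hphi _ _ tT' tauT; have := hz _ _ tT' tauT.
rewrite (ger0_norm ttau0) !ler_norml => /andP[? _] /andP[_ ?].
lra.
Qed.

(** * The explicit bound *)

Lemma beta_gt0 {R : realType} (lam c : R) :
  0 < lam < 1 -> 0 < c -> 0 < beta lam c.
Proof.
move=> /andP[lam0 lam1] c0; rewrite /beta divr_gt0 ?powR_gt0// subr_gt0.
have lam'0 : 0 < 1 - lam by rewrite subr_gt0.
rewrite -(@mulr_powRB1 _ lam (1 / (1 - lam))) ?divr_gt0 ?(ltW lam0)//.
have -> : 1 / (1 - lam) - 1 = lam / (1 - lam) by field; rewrite gt_eqF.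
by rewrite gtr_pMl ?powR_gt0.
Qed.

Lemma holder_on_le {R : realType} (T lam K L : R) (f : R -> R) :
  K <= L -> holder_on T lam K f -> holder_on T lam L f.
Proof.
move=> KL hf s t sT tT; apply: le_trans (hf _ _ sT tT) _.
by rewrite ler_wpM2r ?powR_ge0.
Qed.

(** A value of [Lambda_tilde * e `^ (gamma * lam + lam - 1)] up to which the
    barrier argument works at the level [e]: the first term makes the noise
    weaker than the drift, the second one keeps [e] below the initial distance
    to the curve and below [ystar]. *)
Definition barrier_constant {R : realType} (lam c : R) : R :=
  Num.min ((2 * c) `^ lam / 4) ((2 * beta lam c) `^ (lam - 1)).

Lemma barrier_constant_gt0 {R : realType} (lam c : R) :
  0 < lam < 1 -> 0 < c -> 0 < barrier_constant lam c.
Proof.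
move=> lam01 c0; have b0 := beta_gt0 lam01 c0.
rewrite lt_min; apply/andP; split; last by rewrite powR_gt0// pmulr_rgt0.
by rewrite divr_gt0// powR_gt0// mulr_gt0.
Qed.

(** This is [(e / 2) `^ (- r)] for the level [e] that corresponds to
    [Lambda_tilde = 1]. *)
Definition moment_constant {R : realType} (lam gamma c r : R) : R :=
  2 `^ r * barrier_constant lam c `^ (- (r / (gamma * lam + lam - 1))).

(** The level [e] is chosen as large as [barrier_constant] permits, so that
    [e] is a multiple of [Lambda_tilde `^ (- 1 / (gamma * lam + lam - 1))]. *)
Lemma path_solution_inverse_moment {R : realType}
    (T lam gamma c r ystar y0 K L : R) (phi z y : R -> R) b :
  0 < lam < 1 -> 0 < gamma -> 0 < gamma * lam + lam - 1 -> 0 < c -> 0 < r ->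
  0 < ystar -> phi 0 < y0 -> 0 < L ->
  holder_on T lam K phi -> holder_on T lam L z ->
  drift_continuous phi T b -> drift_explosive phi T ystar c gamma b ->
  path_solution T phi b y0 z y ->
  forall t, t \in `[0, T] ->
    (y t - phi t) `^ (- r) <= moment_constant lam gamma c r *
      Lambda_tilde lam gamma c ystar K phi y0 L
        `^ (r / (gamma * lam + lam - 1)).
Proof.
move=> lam01 gamma0 kappa0 c0 r0 ystar0 phiy0 L0 hphi hz cb eb sol t tT.
set kappa := gamma * lam + lam - 1 in kappa0 *.
set Lt := Lambda_tilde _ _ _ _ _ _ _ _; set q := barrier_constant lam c.
set m := Num.min (y0 - phi 0) ystar.
have q0 : 0 < q by exact: barrier_constant_gt0.
have m0 : 0 < m by rewrite lt_min subr_gt0 phiy0.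
have LLt : L <= Lt by rewrite le_max lexx.
have KLt : K <= Lt by rewrite !le_max lexx orbT.
have Lt0 : 0 < Lt by exact: lt_le_trans LLt.
pose e := (q / Lt) `^ kappa^-1.
have e0 : 0 < e by rewrite powR_gt0// divr_gt0.
have ekappa : e `^ kappa = q / Lt.
  by rewrite -powRrM mulVf ?gt_eqF// powRr1// divr_ge0 ?ltW.
(* By the third term in the maximum defining [Lambda_tilde]: in terms of
   [kappa]-th powers, [q / Lt] is at most [(m / 2) `^ kappa]. *)
have em : e <= m / 2.
  rewrite leNgt; apply/negP => /(gt0_ltr_powR kappa0).
  rewrite !nnegrE ?divr_ge0 ?(ltW m0) ?(ltW e0)// => /(_ isT isT).
  rewrite ltNge ekappa ler_pdivrMr// => /negP; apply.
  have : (2 * beta lam c) `^ (lam - 1) * (m / 2) `^ (- kappa) <= Lt.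
    rewrite /Lt /Lambda_tilde !le_max (_ : - kappa = 1 - lam - gamma * lam).
      by rewrite lexx !orbT.
    by rewrite /kappa; lra.
  rewrite powRN ler_pdivrMr ?powR_gt0 ?divr_gt0// [Lt * _]mulrC.
  by apply: le_trans; rewrite ge_min lexx orbT.
have small : 4 * Lt * e `^ kappa <= (2 * c) `^ lam.
  rewrite ekappa (_ : 4 * Lt * (q / Lt) = q * 4); last by field; rewrite gt_eqF.
  by rewrite -ler_pdivlMr// ge_min lexx.
have em' : e <= m by lra.
have := path_solution_half_barrier lam01 gamma0 c0 Lt0 e0 (holder_on_le KLt hphi)
  (holder_on_le LLt hz) cb eb sol _ _ small tT.
have [-> ->] : e <= y0 - phi 0 /\ e <= ystar.
  by move: em'; rewrite le_min => /andP[].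
move=> /(_ isT isT) low.
have e20 : 0 < e / 2 by rewrite divr_gt0.
rewrite (@le_trans _ _ ((e / 2) `^ (- r)))//.
  rewrite !powRN lef_pV2 ?posrE ?powR_gt0 ?(lt_le_trans e20)//.
  by rewrite ge0_ler_powR ?nnegrE ?(ltW r0) ?(ltW e20) ?(le_trans (ltW e20)).
rewrite powRM ?(ltW e0)// mulrC.
have -> : 2^-1 `^ (- r) = 2 `^ r by rewrite -powR_inv1// -powRrM mulN1r opprK.
rewrite /moment_constant -/kappa -/q -mulrA ler_wpM2l ?powR_ge0//.
rewrite /e -powRrM mulrN [kappa^-1 * r]mulrC.
rewrite powRM ?(ltW q0) ?invr_ge0 ?(ltW Lt0)//.
by rewrite -(powR_inv1 (ltW Lt0)) -[X in _ * X <= _]powRrM mulN1r opprK.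
Qed.

(** * Integration over the probability space *)

Section measurable_majorant.
Import HBNNSimple.

(** The function [f] may fail to be measurable: its integral is the supremum of
    the integrals of the simple functions below [f], each of which is
    measurable and almost everywhere below [g]. *)
Lemma le_integral_of_measurable_majorant d (Omega : measurableType d)
    (R : realType) (mu : {measure set Omega -> \bar R}) (f g : Omega -> \bar R) :
  (forall x, 0 <= f x)%E -> (forall x, 0 <= g x)%E ->
  measurable_fun [set: Omega] g ->
  {ae mu, forall x, f x <= g x}%E ->
  (\int[mu]_x f x <= \int[mu]_x g x)%E.
Proof.
move=> f0 g0 mg fg; rewrite ge0_integralTE//.
apply: ge_ereal_sup => _ [h /= hf <-].
rewrite -integralT_nnsfun; apply: ae_ge0_le_integral => //.
- by move=> x _; rewrite lee_fin fun_ge0.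
- exact/measurable_EFinP.
- by apply: filterS fg => x fgx _; exact: le_trans (hf x) fgx.
Qed.

End measurable_majorant.

Theorem theorem2p6 (R : realType) (T lam gamma c r : R)
    (hT : 0 < T) (hlam0 : 0 < lam) (hlam1 : lam < 1)
    (hgamma : 0 < gamma) (hA4 : (1 - lam) / lam < gamma)
    (hc : 0 < c) (hr : 0 < r) :
  0 < beta lam c /\
  exists2 M3 : R, 0 < M3 &
    forall (phi : R -> R) (K ystar y0 : R) (b : R * R -> R)
      (d : measure_display) (Omega : measurableType d) (P : probability Omega R)
      (Z Y : R -> {RV P >-> R}) (Lambda : {RV P >-> R}),
    0 < K -> holder_on T lam K phi ->
    phi 0 < y0 ->
    0 < ystar ->
    drift_continuous phi T b ->
    drift_lipschitz phi T b ->
    drift_explosive phi T ystar c gamma b ->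
    {ae P, forall w, Z 0 w = 0} ->
    holder_modulus T lam Z Lambda ->
    {ae P, forall w, path_solution T phi b y0 (fun t => Z t w) (fun t => Y t w)} ->
    (forall w, path_solution T phi b y0 (fun t => Z t w) (fun t => Y t w) ->
       forall t : R, t \in `[0, T] ->
         (Y t w - phi t) `^ (- r) <=
         M3 * Lambda_tilde lam gamma c ystar K phi y0 (Lambda w)
                `^ (r / (gamma * lam + lam - 1)))
    /\
    ((exists2 Lambda' : {RV P >-> R}, holder_modulus T lam Z Lambda' &
        ('E_P[fun w => (Lambda' w `^ (r / (gamma * lam + lam - 1)))%R] < +oo)%E) ->
     (\int[P]_w ereal_sup [set ((Y t w - phi t) `^ (- r))%:E | t in `[0%R, T]]
        < +oo)%E).
Proof.
have lam01 : 0 < lam < 1 by rewrite hlam0.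
have kappa0 : 0 < gamma * lam + lam - 1.
  by move: hA4; rewrite ltr_pdivrMr// => ?; lra.
split; first exact: beta_gt0.
have M0 : 0 < moment_constant lam gamma c r.
  by rewrite mulr_gt0 ?powR_gt0 ?barrier_constant_gt0.
exists (moment_constant lam gamma c r) => //.
move=> phi K ystar y0 b d Omega P Z Y Lambda K0 hphi phiy0 ystar0 cb _ eb _.
move=> hLambda aesol.
have bound (L : Omega -> R) : holder_modulus T lam Z L ->
    forall w, path_solution T phi b y0 (fun t => Z t w) (fun t => Y t w) ->
    forall t : R, t \in `[0, T] -> (Y t w - phi t) `^ (- r) <=
      moment_constant lam gamma c r * Lambda_tilde lam gamma c ystar K phi y0 (L w)
        `^ (r / (gamma * lam + lam - 1)).
  move=> hL w sol t tT; have [Lw0 hz] := hL w.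
  exact: (path_solution_inverse_moment _ _ _ _ _ _ _ _ hphi hz cb eb sol).
split; first exact: bound.
move=> [L hL]; rewrite unlock => EL.
set p := r / _ in EL bound *.
have p0 : 0 <= p by rewrite divr_ge0 ?ltW.
(* The deterministic part of [Lambda_tilde]. *)
pose C := Num.max K ((2 * beta lam c) `^ (lam - 1) *
     (Num.min (y0 - phi 0) ystar / 2) `^ (1 - lam - gamma * lam)).
have C0 : 0 < C by rewrite lt_max K0.
pose M := moment_constant lam gamma c r.
pose G w := (M%:E * ((L w `^ p)%:E + (C `^ p)%:E))%E.
have mLp : measurable_fun setT (fun w => (L w `^ p)%:E).
  by apply/measurable_EFinP; apply: (measurableT_comp (measurable_powR p)).
have mLpC : measurable_fun setT (fun w => (L w `^ p)%:E + (C `^ p)%:E)%E.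
  exact: emeasurable_funD.
apply: (@le_lt_trans _ _ (\int[P]_w G w)%E); last first.
  rewrite ge0_integralZl ?lee_fin ?(ltW M0)//; last first.
    by move=> w _; rewrite adde_ge0 ?lee_fin ?powR_ge0.
  rewrite ge0_integralD//; [|by move=> ? _; rewrite lee_fin powR_ge0..].
  rewrite integral_cst//= probability_setT mule1.
  apply: lte_mul_pinfty; rewrite ?lee_fin ?(ltW M0)//.
  by rewrite lte_add_pinfty// ltry.
apply: le_integral_of_measurable_majorant.
- move=> w; apply: le_ereal_sup_tmp; exists ((Y 0 w - phi 0) `^ (- r))%:E.
    by exists 0 => //=; rewrite in_itv/= lexx ltW.
  by rewrite lee_fin powR_ge0.
- by move=> w; rewrite mule_ge0 ?adde_ge0 ?lee_fin ?powR_ge0 ?(ltW M0).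
- exact: measurable_funeM.
apply: filterS aesol => w sol; apply: ge_ereal_sup => _ [t tT <-].
rewrite /G -EFinD -EFinM lee_fin (le_trans (bound _ hL _ sol _ _))//.
rewrite ler_wpM2l ?(ltW M0)//.
have [Lw0 _] := hL w.
have -> : Lambda_tilde lam gamma c ystar K phi y0 (L w) = Num.max (L w) C by [].
(* The [p]-th power of a maximum is at most the sum of the [p]-th powers. *)
have [LC|CL] := leP (L w) C; first by rewrite lerDr powR_ge0.
by rewrite lerDl powR_ge0.
Qed.
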